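(* Let $\mathbf{W}\in\mathbb{R}^{k\times d}$ be a nonzero matrix, $b\in\mathbb{R}^k$, and let $\sigma:\mathbb{R}\to\mathbb{R}$ be a non-decreasing $1$-Lipschitz function. Then the Convex Potential Layer $$\mathbb{R}^d\to\mathbb{R}^d,\qquad x\mapsto x-\frac{2}{\lVert\mathbf{W}\rVert_2^2}\,\mathbf{W}^\top\sigma(\mathbf{W}x+b)$$ is $1$-Lipschitz for the Euclidean norm.
   Context: $\sigma$ is applied element-wise to vectors in $\mathbb{R}^k$. $\lVert\mathbf{W}\rVert_2=\max_{x\ne0}\frac{\lVert\mathbf{W}x\rVert_2}{\lVert x\rVert_2}$ is the spectral norm (largest singular value) of $\mathbf{W}$. *)

(* Defs.v *)
From HB Require Import structures.
From mathcomp Require Import all_boot all_order all_algebra.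
From mathcomp Require Import all_classical all_reals all_analysis.
Import Order.TTheory GRing.Theory Num.Theory.
Import numFieldNormedType.Exports.

Set Implicit Arguments.
Unset Strict Implicit.
Unset Printing Implicit Defensive.

Local Open Scope classical_set_scope.
Local Open Scope ring_scope.

(* The norm notation `|x| on matrices is the library's max norm, hence a
   separate Euclidean norm. *)
Definition l2norm {R : realType} {n : nat} (x : 'cV[R]_n) : R :=
  Num.sqrt (\sum_(i < n) x i ord0 ^+ 2).

(* The set of ratios is bounded, and nonempty as soon as 0 < d; in finite
   dimension its supremum is attained, so that sup is the maximum. *)
Definition spectral_norm {R : realType} {k d : nat} (W : 'M[R]_(k, d)) : R :=
  sup [set l2norm (W *m x) / l2norm x | x in [set x : 'cV[R]_d | x != 0]].

(* The library's k.-lipschitz would use the max norm on column vectors. *)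
Definition l2_lipschitz {R : realType} {m n : nat} (L : R)
    (f : 'cV[R]_m -> 'cV[R]_n) : Prop :=
  forall x y : 'cV[R]_m, l2norm (f x - f y) <= L * l2norm (x - y).

Definition convex_potential_layer {R : realType} {k d : nat}
    (W : 'M[R]_(k, d)) (b : 'cV[R]_k) (sigma : R -> R) (x : 'cV[R]_d) :
    'cV[R]_d :=
  x - (2 / spectral_norm W ^+ 2) *: (W^T *m map_mx sigma (W *m x + b)).

(* Main.v *)
Require Import Defs.
From mathcomp Require Import all_boot all_order all_algebra.
From mathcomp Require Import all_classical all_reals all_analysis.
From mathcomp Require Import ring lra.
Import Order.TTheory GRing.Theory Num.Theory.
Import numFieldNormedType.Exports.
Local Open Scope classical_set_scope.
Local Open Scope ring_scope.

Set Implicit Arguments.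
Unset Strict Implicit.
Unset Printing Implicit Defensive.

(* Write D = sigma(Wx + b) - sigma(Wy + b) and h = 2 / ||W||^2. Then
     |v - h W^T D|^2 = |v|^2 - 2 h <Wv, D> + h^2 |W^T D|^2,   v = x - y.
   A monotone 1-Lipschitz sigma is firmly nonexpansive, |D|^2 <= <Wv, D>, while
   |W^T D|^2 <= ||W||^2 |D|^2; for this h the last two terms sum to at most 0. *)

Definition dotv {R : realType} {n : nat} (x y : 'cV[R]_n) : R :=
  \sum_(i < n) x i ord0 * y i ord0.

Lemma dotvC (R : realType) (n : nat) (x y : 'cV[R]_n) : dotv x y = dotv y x.
Proof. by apply: eq_bigr => i _; rewrite mulrC. Qed.

Lemma dotvv_ge0 (R : realType) (n : nat) (x : 'cV[R]_n) : 0 <= dotv x x.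
Proof. by apply: sumr_ge0 => i _; rewrite -expr2 sqr_ge0. Qed.

Lemma dotvv_eq0 (R : realType) (n : nat) (x : 'cV[R]_n) :
  (dotv x x == 0) = (x == 0).
Proof.
rewrite psumr_eq0 => [|i _]; last by rewrite -expr2 sqr_ge0.
apply/allP/eqP => [x0|-> i _]; last by rewrite /= mxE mulr0.
apply/colP => i; apply/eqP; rewrite mxE.
by have := x0 i (mem_index_enum i); rewrite /= mulf_eq0 orbb.
Qed.

Lemma dotv_trmx (R : realType) (m n : nat) (A : 'M[R]_(m, n)) (z : 'cV[R]_m)
    (x : 'cV[R]_n) : dotv (A^T *m z) x = dotv z (A *m x).
Proof.
have dotvE p (u v : 'cV[R]_p) : dotv u v = (u^T *m v) ord0 ord0.
  by rewrite mxE; apply: eq_bigr => i _; rewrite mxE.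
by rewrite !dotvE trmx_mul trmxK mulmxA.
Qed.

Lemma dotv_subZ (R : realType) (n : nat) (x y : 'cV[R]_n) (a : R) :
  dotv (x - a *: y) (x - a *: y) =
  dotv x x - 2 * a * dotv x y + a ^+ 2 * dotv y y.
Proof.
rewrite /dotv !mulr_sumr -sumrB -big_split /=.
by apply: eq_bigr => i _; rewrite !mxE; ring.
Qed.

(** Cauchy-Schwarz. For [y != 0], subtracting from [x] its projection on [y] leaves a vector whose
    squared norm, necessarily nonnegative, is the difference of the two sides divided by
    [dotv y y]. *)
Lemma dotv_sqr_le (R : realType) (n : nat) (x y : 'cV[R]_n) :
  dotv x y ^+ 2 <= dotv x x * dotv y y.
Proof.
have [->|y0] := eqVneq y 0.
  have dotv0 (z : 'cV[R]_n) : dotv z 0 = 0.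
    by rewrite /dotv big1// => i _; rewrite mxE mulr0.
  by rewrite !dotv0 expr0n mulr0.
have yy_neq0 : dotv y y != 0 by rewrite dotvv_eq0.
have yy_gt0 : 0 < dotv y y by rewrite lt_def yy_neq0 dotvv_ge0.
have := dotvv_ge0 (x - (dotv x y / dotv y y) *: y).
rewrite dotv_subZ => h.
rewrite -subr_ge0 -(pmulr_rge0 _ (_ : 0 < (dotv y y)^-1)) ?invr_gt0//.
by apply: le_trans h _; rewrite le_eqVlt; apply/orP; left; apply/eqP; field.
Qed.

Lemma l2normE (R : realType) (n : nat) (x : 'cV[R]_n) :
  l2norm x = Num.sqrt (dotv x x).
Proof. by congr Num.sqrt; apply: eq_bigr => i _; rewrite expr2. Qed.

Lemma l2norm_ge0 (R : realType) (n : nat) (x : 'cV[R]_n) : 0 <= l2norm x.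
Proof. exact: sqrtr_ge0. Qed.

Lemma sqr_l2norm (R : realType) (n : nat) (x : 'cV[R]_n) :
  l2norm x ^+ 2 = dotv x x.
Proof. by rewrite l2normE sqr_sqrtr ?dotvv_ge0. Qed.

Lemma dotv_le_l2norm (R : realType) (n : nat) (x y : 'cV[R]_n) :
  dotv x y <= l2norm x * l2norm y.
Proof.
apply: le_trans (ler_norm _) _.
by rewrite -ler_sqr ?nnegrE ?mulr_ge0 ?l2norm_ge0// exprMn !sqr_l2norm
  real_normK ?num_real// dotv_sqr_le.
Qed.

Lemma l2norm_eq0 (R : realType) (n : nat) (x : 'cV[R]_n) :
  (l2norm x == 0) = (x == 0).
Proof. by rewrite -sqrf_eq0 sqr_l2norm dotvv_eq0. Qed.

(** Cauchy-Schwarz on each row. The Frobenius norm serves only as an explicit upper bound on the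
    ratios whose [sup] is the spectral norm. *)
Lemma l2norm_mulmx_le_frobenius (R : realType) (m n : nat) (A : 'M[R]_(m, n))
    (x : 'cV[R]_n) :
  l2norm (A *m x) <= Num.sqrt (\sum_(i < m) \sum_(j < n) A i j ^+ 2) * l2norm x.
Proof.
have F0 : 0 <= \sum_(i < m) \sum_(j < n) A i j ^+ 2.
  by apply: sumr_ge0 => i _; apply: sumr_ge0 => j _; rewrite sqr_ge0.
rewrite (l2normE x) -sqrtrM// [l2norm _]/l2norm ler_wsqrtr// mulr_suml.
apply: ler_sum => i _.
have -> : (A *m x) i ord0 = dotv (row i A)^T x.
  by rewrite mxE; apply: eq_bigr => j _; rewrite !mxE.
apply: le_trans (dotv_sqr_le _ _) _.
by rewrite le_eqVlt; apply/orP; left; apply/eqP; congr (_ * _);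
  apply: eq_bigr => j _; rewrite !mxE expr2.
Qed.

Lemma l2norm_mulmx_le (R : realType) (m n : nat) (A : 'M[R]_(m, n))
    (x : 'cV[R]_n) : l2norm (A *m x) <= spectral_norm A * l2norm x.
Proof.
have [->|x0] := eqVneq x 0.
  have n0 p : l2norm (0 : 'cV[R]_p) = 0 by apply/eqP; rewrite l2norm_eq0.
  by rewrite mulmx0 !n0 mulr0.
have pos (y : 'cV[R]_n) : y != 0 -> 0 < l2norm y.
  by move=> y0; rewrite lt_def l2norm_eq0 y0 l2norm_ge0.
(* A [sup] dominates the elements of its set only once that set is known to be bounded above. *)
rewrite -ler_pdivrMr ?pos//; apply: ub_le_sup; last by exists x.
exists (Num.sqrt (\sum_(i < m) \sum_(j < n) A i j ^+ 2)) => _ [y /= y0 <-].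
by rewrite ler_pdivrMr ?pos// l2norm_mulmx_le_frobenius.
Qed.

Lemma spectral_norm_ge0 (R : realType) (m n : nat) (A : 'M[R]_(m, n)) :
  0 <= spectral_norm A.
Proof.
have [[[r Ar] ubA]|/sup_out A0] := pselect (has_sup
  [set l2norm (A *m x) / l2norm x | x in [set x : 'cV[R]_n | x != 0]]).
  apply: le_trans (ub_le_sup ubA Ar).
  by case: Ar => x _ <-; rewrite divr_ge0 ?l2norm_ge0.
(* Without a supremum, as for the empty set of ratios when [n = 0], [sup] takes its default value
   0. *)
by rewrite /spectral_norm A0.
Qed.

(** Duality replaces singular values: |A^T z|^2 = <z, A A^T z> <= |z| ||A|| |A^T z|, and a nonzero
    factor |A^T z| cancels. *)
Lemma l2norm_trmx_mulmx_le (R : realType) (m n : nat) (A : 'M[R]_(m, n))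
    (z : 'cV[R]_m) : l2norm (A^T *m z) <= spectral_norm A * l2norm z.
Proof.
have [t0|t_neq0] := eqVneq (l2norm (A^T *m z)) 0.
  by rewrite t0 mulr_ge0 ?spectral_norm_ge0 ?l2norm_ge0.
have t_gt0 : 0 < l2norm (A^T *m z) by rewrite lt_def t_neq0 l2norm_ge0.
rewrite -(ler_pM2r t_gt0) -expr2 sqr_l2norm dotv_trmx.
apply: le_trans (dotv_le_l2norm _ _) _.
by rewrite mulrAC mulrC ler_wpM2r ?l2norm_ge0// l2norm_mulmx_le.
Qed.

(** By monotonicity the two increments have the same sign, so their product equals the product of
    their absolute values; the Lipschitz bound then replaces |s - t| by the smaller increment of
    [sigma]. *)
Lemma firmly_nonexpansive (R : realType) (sigma : R -> R)
    (sigma_ndecr : {homo sigma : x y / x <= y})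
    (sigma_lip : 1.-lipschitz sigma) (s t : R) :
  (sigma s - sigma t) ^+ 2 <= (s - t) * (sigma s - sigma t).
Proof.
have lip : `|sigma s - sigma t| <= `|s - t|.
  by have := sigma_lip (s, t) (conj I I); rewrite /= mul1r.
have ge0 : 0 <= (s - t) * (sigma s - sigma t).
  have [st|/ltW ts] := leP s t.
    by rewrite mulr_le0 ?subr_le0 ?sigma_ndecr.
  by rewrite mulr_ge0 ?subr_ge0 ?sigma_ndecr.
by rewrite -(ger0_norm ge0) normrM -real_normK ?num_real// expr2 ler_wpM2r.
Qed.

Theorem mainTheorem4 (R : realType) (k d : nat) (W : 'M[R]_(k, d))
    (b : 'cV[R]_k) (sigma : R -> R)
    (W_neq0 : W != 0)
    (sigma_ndecr : {homo sigma : x y / x <= y})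
    (sigma_lip : 1.-lipschitz sigma) :
  l2_lipschitz 1 (convex_potential_layer W b sigma).
Proof.
move=> x y; rewrite mul1r /convex_potential_layer.
set s := spectral_norm W; set h := 2 / s ^+ 2.
set D := map_mx sigma (W *m x + b) - map_mx sigma (W *m y + b).
have -> : x - h *: (W^T *m map_mx sigma (W *m x + b)) -
    (y - h *: (W^T *m map_mx sigma (W *m y + b))) = x - y - h *: (W^T *m D).
  by rewrite mulmxBr scalerBr !opprB addrACA [RHS]addrACA (addrC (- y)).
have DD : dotv D D <= dotv (x - y) (W^T *m D).
  (* Moving [W^T] across the product gives <D, W(x - y)>. As [sigma] acts entrywise, the scalar
     inequality is applied to each coordinate. *)
  rewrite dotvC dotv_trmx; apply: ler_sum => i _.
  have -> : W *m (x - y) = W *m x + b - (W *m y + b).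
    by rewrite mulmxBr opprD addrACA subrr addr0.
  rewrite /D; move: (W *m x + b) (W *m y + b) => u w.
  by rewrite !mxE -expr2 [leRHS]mulrC firmly_nonexpansive.
have WD : dotv (W^T *m D) (W^T *m D) <= s ^+ 2 * dotv D D.
  rewrite -!sqr_l2norm -exprMn ler_sqr ?nnegrE ?mulr_ge0 ?l2norm_ge0
    ?spectral_norm_ge0//.
  exact: l2norm_trmx_mulmx_le.
have h_ge0 : 0 <= h by rewrite divr_ge0 ?sqr_ge0.
have hs : h ^+ 2 * s ^+ 2 <= 2 * h.
  (* If [s = 0] the left side vanishes; otherwise both sides equal 4 / s^2, which is where the
     constant 2 in the layer is exactly critical. *)
  have [s0|s0] := eqVneq s 0; first by rewrite s0 expr0n mulr0 mulr_ge0.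
  by rewrite le_eqVlt; apply/orP; left; apply/eqP; rewrite /h; field.
rewrite !l2normE ler_wsqrtr// dotv_subZ.
(* The chain left to [nra] is h^2 |W^T D|^2 <= h^2 s^2 |D|^2 <= 2 h |D|^2 <= 2 h <x - y, W^T D>; its
   middle link needs |D|^2 >= 0. *)
have := dotvv_ge0 D.
nra.
Qed.
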